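(* Suppose that $(N^{(1)},N^{(2)},N^{(3)})\in \tilde{\mathcal R}_{11}$. Then there are functions $f_1\in\mathcal H_{N^{(1)}}$, $f_2\in\mathcal H_{N^{(2)}}$ and $g\in \mathcal H_{K_{(N^{(1)},N^{(2)},N^{(3)})}}$ such that $$N^{(i)}(\lambda,\mathbf z,\mu,\mathbf w)=\overline{f_i(\mu,\mathbf w)}\,f_i(\lambda,\mathbf z),\quad i=1,2,$$ and $$K_{(N^{(1)},N^{(2)},N^{(3)})}(\lambda,\mathbf z,\mu,\mathbf w)=\overline{g(\mu,\mathbf w)}\,g(\lambda,\mathbf z)$$ for all $\lambda,\mu\in\mathbb D$ and $\mathbf z=(z_1,z_2),\mathbf w=(w_1,w_2)\in\mathbb D^2$, and a function $\Xi\in\mathcal S_1(\mathbb C^3,\mathbb C^3)$ such that $$\Xi(\lambda)\begin{pmatrix}1\\ z_1f_1(\lambda,\mathbf z)\\ z_2f_2(\lambda,\mathbf z)\end{pmatrix}=\begin{pmatrix}g(\lambda,\mathbf z)\\ f_1(\lambda,\mathbf z)\\ f_2(\lambda,\mathbf z)\end{pmatrix}$$ for all $\lambda\in\mathbb D$ and $\mathbf z=(z_1,z_2)\in\mathbb D^2$.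
   Context: $\mathbb D$ is the open unit disc. $\mathcal S_1(\mathbb C^3,\mathbb C^3)$ is the set of analytic $3\times3$ matrix functions $F$ on $\mathbb D$ with $\|F(\lambda)\|\le1$ (operator norm) for all $\lambda\in\mathbb D$. An analytic kernel on $\mathbb D^3$ is a positive semidefinite function $N(\lambda,\mathbf z,\mu,\mathbf w)$ of $(\lambda,\mathbf z),(\mu,\mathbf w)\in\mathbb D\times\mathbb D^2=\mathbb D^3$, analytic in $(\lambda,\mathbf z)$ and conjugate-analytic in $(\mu,\mathbf w)$. $\mathcal H_N$ denotes the Hilbert function space on $\mathbb D^3$ with reproducing kernel $N$, and the rank of $N$ is $\dim\mathcal H_N$. For analytic kernels $N^{(1)},N^{(2)},N^{(3)}$ on $\mathbb D^3$, put $$K_{(N^{(1)},N^{(2)},N^{(3)})}=1-(1-\bar w_1z_1)N^{(1)}-(1-\bar w_2z_2)N^{(2)}-(1-\bar\mu\lambda)N^{(3)},$$ all functions being evaluated at $(\lambda,\mathbf z,\mu,\mathbf w)$, $\mathbf z=(z_1,z_2)$, $\mathbf w=(w_1,w_2)$. $\tilde{\mathcal R}_{11}$ is the set of triples $(N^{(1)},N^{(2)},N^{(3)})$ of analytic kernels on $\mathbb D^3$ such that $K_{(N^{(1)},N^{(2)},N^{(3)})}$ is also an analytic kernel on $\mathbb D^3$ and $N^{(1)}$, $N^{(2)}$, $K_{(N^{(1)},N^{(2)},N^{(3)})}$ are all of rank 1. *)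

(* Defs.v *)
(* Mathematical Components and MathComp-Analysis; the complex field is R[i]
   for an abstract R : realType. *)
From HB Require Import structures.
From mathcomp Require Import all_boot all_order all_algebra.
From mathcomp Require Import all_classical all_reals all_analysis.
From mathcomp Require Import complex.

Set Implicit Arguments.
Unset Strict Implicit.
Unset Printing Implicit Defensive.

Import Order.TTheory GRing.Theory Num.Theory.
Import numFieldNormedType.Exports.

Local Open Scope classical_set_scope.
Local Open Scope ring_scope.

Section HilbertFunctionSpaces.
Variables (R : realType) (X : Type).
Local Notation C := R[i].
Implicit Types (H : set (X -> C)) (N : X -> X -> C).

(* In R[i], [0 <= z] means that z is real and nonnegative. *)
Definition positive_semidefinite N : Prop :=
  forall (n : nat) (x : 'I_n -> X) (c : 'I_n -> C),
    0 <= \sum_(i < n) \sum_(j < n) (c i)^* * c j * N (x i) (x j).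

Definition is_subspace H : Prop :=
  H (fun=> 0) /\
  (forall (a : C) f g, H f -> H g -> H (fun x => a * f x + g x)).

(* Linear in the first argument. *)
Definition is_inner_product H (ip : (X -> C) -> (X -> C) -> C) : Prop :=
  [/\ forall (a : C) f g h, H f -> H g -> H h ->
        ip (fun x => a * f x + g x) h = a * ip f h + ip g h,
      forall f g, H f -> H g -> ip g f = (ip f g)^*,
      forall f, H f -> 0 <= ip f f
    & forall f, H f -> ip f f = 0 -> f = (fun=> 0)].

Definition ip_dist (ip : (X -> C) -> (X -> C) -> C) (f g : X -> C) : C :=
  let d := fun x => f x - g x in sqrtC (ip d d).

Definition is_complete H (ip : (X -> C) -> (X -> C) -> C) : Prop :=
  forall u : nat -> X -> C,
    (forall n, H (u n)) ->
    (forall e : C, 0 < e -> exists n0 : nat, forall m n : nat,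
        (n0 <= m)%N -> (n0 <= n)%N -> ip_dist ip (u m) (u n) < e) ->
    exists2 f, H f &
      forall e : C, 0 < e -> exists n0 : nat, forall n : nat,
        (n0 <= n)%N -> ip_dist ip (u n) f < e.

(* H, with the inner product ip, is a Hilbert space of functions on X with
   reproducing kernel N: f y = <f, N(., y)>. *)
Definition is_hilbert_function_space N H (ip : (X -> C) -> (X -> C) -> C)
    : Prop :=
  [/\ is_subspace H, is_inner_product H ip, is_complete H ip,
      forall y, H (fun x => N x y)
    & forall f y, H f -> f y = ip f (fun x => N x y)].

(* For positive semidefinite N, exactly one pair (H, ip) satisfies
   [is_hilbert_function_space N H ip] up to the values of ip off H
   (Moore-Aronszajn), so this is the underlying set of that space. *)
Definition rkhs N : set (X -> C) :=
  [set f | exists H ip, is_hilbert_function_space N H ip /\ H f].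

Definition has_dimension H (n : nat) : Prop :=
  exists e : 'I_n -> X -> C,
    [/\ forall i, H (e i),
        forall c : 'I_n -> C,
          (forall x, \sum_(i < n) c i * e i x = 0) -> forall i, c i = 0
      & forall f, H f ->
          exists c : 'I_n -> C, forall x, f x = \sum_(i < n) c i * e i x].

Definition kernel_rank N (n : nat) : Prop := has_dimension (rkhs N) n.

End HilbertFunctionSpaces.

Section Analytic.
Variable R : realType.
Local Notation C := R[i].

Definition disc : set C := [set z | `|z| < 1].

(* A point (lambda, (z_1, z_2)) of D x D^2. *)
Definition polydisc : Type := (disc * (disc * disc))%type.

Definition polydisc_val (x : polydisc) : C^o * (C^o * C^o) :=
  (val x.1, (val x.2.1, val x.2.2)).

Definition disc_val (l : disc) : C^o := val l.

(* emb identifies X with an open subset of V; f is analytic when some (any)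
   extension of f to V is complex differentiable at every point of that
   subset. [differentiable] is over the scalar field R[i]. *)
Definition analytic_along (X : Type) (V W : normedModType C) (emb : X -> V)
    (f : X -> W) : Prop :=
  exists F : V -> W,
    forall x, F (emb x) = f x /\ differentiable F (emb x).

Definition analytic_kernel (N : polydisc -> polydisc -> C) : Prop :=
  [/\ positive_semidefinite N,
      forall y, analytic_along polydisc_val (fun x => N x y : C^o)
    & forall x, analytic_along polydisc_val (fun y => (N x y)^* : C^o)].

Definition l2norm n (v : 'cV[C]_n) : R :=
  Num.sqrt (\sum_(i < n) complex.Re `|v i 0| ^+ 2).

Definition opnorm m n (A : 'M[C]_(m, n)) : R :=
  sup [set l2norm (A *m v) | v in [set v : 'cV[C]_n | l2norm v <= 1]].

(* S_1(C^3, C^3) *)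
Definition schur_class3 (F : disc -> 'M[C]_3) : Prop :=
  analytic_along disc_val F /\ (forall l, opnorm (F l) <= 1).

Definition Kfun (N1 N2 N3 : polydisc -> polydisc -> C) (x y : polydisc) : C :=
  let: (l, (z1, z2)) := polydisc_val x in
  let: (m, (w1, w2)) := polydisc_val y in
  1 - (1 - w1^* * z1) * N1 x y - (1 - w2^* * z2) * N2 x y
    - (1 - m^* * l) * N3 x y.

(* \tilde R_{11} *)
Definition Rtilde11 (N1 N2 N3 : polydisc -> polydisc -> C) : Prop :=
  [/\ [/\ analytic_kernel N1, analytic_kernel N2 & analytic_kernel N3],
      analytic_kernel (Kfun N1 N2 N3),
      kernel_rank N1 1, kernel_rank N2 1 & kernel_rank (Kfun N1 N2 N3) 1].

Definition col3 (a b c : C) : 'cV[C]_3 := \col_(i < 3) [:: a; b; c]`_i.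

End Analytic.

Arguments disc : clear implicits.
Arguments polydisc : clear implicits.

(* Main.v *)
Require Import Defs.
From HB Require Import structures.
From mathcomp Require Import all_boot all_order all_algebra.
From mathcomp Require Import all_classical all_reals all_analysis.
From mathcomp Require Import complex.
From mathcomp Require Import ring lra.
Import Order.TTheory GRing.Theory Num.Theory.
Import numFieldNormedType.Exports.
Local Open Scope ring_scope.

Set Implicit Arguments.
Unset Strict Implicit.
Unset Printing Implicit Defensive.

(** A kernel of rank one has the form conj(f(y)) f(x), with f in its Hilbert
    space ([rank_one_kernel]). With f1, f2 and g obtained in this way, put
    u = (1, z1 f1, z2 f2) and v = (g, f1, f2). The definition of K then says that
    for all points x = (lambda, z) and y = (mu, w),

      (u(x), u(y)) - (v(x), v(y)) = (1 - conj(mu) lambda) N3(x, y),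

    and the claim is that a positive kernel N3 in such an identity forces
    v(x) = Xi(lambda) u(x) for some Schur function Xi
    ([kernel_interpolation], which holds for any number of coordinates and any
    set of points).

    At finitely many points this is the lurking isometry argument
    ([finite_interpolation]). Factor N3 as (k_x, k_y) with finite vectors k_x;
    then (u(x), lambda k_x) and (v(x), k_x) have the same Gram matrix, so a
    contractive block matrix with blocks A, B, K, D maps the first family to the
    second, and eliminating k_x shows that its transfer function
    A + z B (1 - z D)^-1 K sends u(x) to v(x). This function is contractive on
    the disc.

    The passage to all points is a compactness argument: the values of the
    finite solutions are bounded, hence converge along an ultrafilter on the
    finite sets of points. Contractivity and the interpolation conditions survive
    pointwise limits. So does analyticity, because transfer functions satisfy
    a first-order Taylor estimate whose constants depend only on the points of
    the disc at which it is taken ([schur_jet]); this estimate is inherited by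
    the limit and makes it complex differentiable.

    Vectors are rows and matrices act on the right until the last step, where
    Xi is the transpose of the limit. *)

(** * Operator bounds on complex matrices *)

Section OperatorBounds.
Local Open Scope sesquilinear_scope.
Variable C : numClosedFieldType.

Definition sqnorm n (v : 'rV[C]_n) : C := \sum_j `|v 0 j| ^+ 2.

Lemma sqnormE n (v : 'rV[C]_n) : sqnorm v = (v *m v^t*) 0 0.
Proof.
by rewrite mxE; apply: eq_bigr => j _; rewrite !mxE normCK.
Qed.

Lemma sqnorm_ge0 n (v : 'rV[C]_n) : 0 <= sqnorm v.
Proof. by apply: sumr_ge0 => j _; rewrite exprn_ge0. Qed.

Lemma sqnorm0 n : sqnorm (0 : 'rV[C]_n) = 0.
Proof. by rewrite sqnormE mul0mx mxE. Qed.

Lemma sqnorm_coord n (v : 'rV[C]_n) j : `|v 0 j| ^+ 2 <= sqnorm v.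
Proof.
rewrite /sqnorm (bigD1 j) //= lerDl.
by apply: sumr_ge0 => k _; rewrite exprn_ge0.
Qed.

Lemma sqnorm_eq0 n (v : 'rV[C]_n) : sqnorm v <= 0 -> v = 0.
Proof.
move=> v0; apply/rowP => j; rewrite mxE; apply/eqP.
rewrite -normr_eq0 -sqrf_eq0 eq_le exprn_ge0 // andbT.
exact: le_trans (sqnorm_coord v j) v0.
Qed.

Lemma sqnorm_row_mx m n (u : 'rV[C]_m) (v : 'rV[C]_n) :
  sqnorm (row_mx u v) = sqnorm u + sqnorm v.
Proof.
rewrite /sqnorm big_split_ord; congr (_ + _); apply: eq_bigr => j _.
  by rewrite row_mxEl.
by rewrite row_mxEr.
Qed.

Lemma sqnormZ n a (v : 'rV[C]_n) : sqnorm (a *: v) = `|a| ^+ 2 * sqnorm v.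
Proof.
by rewrite /sqnorm mulr_sumr; apply: eq_bigr => j _; rewrite mxE normrM exprMn.
Qed.

Lemma sqnorm_delta n (i : 'I_n) : sqnorm (delta_mx 0 i : 'rV_n) = 1.
Proof.
rewrite /sqnorm (bigD1 i) //= mxE !eqxx normr1 expr1n big1 ?addr0 // => j ji.
by rewrite mxE (negbTE ji) andbF normr0 expr0n.
Qed.

(** The operator norm of the right multiplication by M is at most k. Phrasing
    it with squared norms keeps everything algebraic: bounds compose by
    substitution and pass to a limit entry by entry. *)
Definition op_bound m n (k : C) (M : 'M[C]_(m, n)) :=
  forall v, sqnorm (v *m M) <= k ^+ 2 * sqnorm v.

Lemma op_boundM m n p (k l : C) (M : 'M[C]_(m, n)) (N : 'M[C]_(n, p)) :
  0 <= l -> op_bound k M -> op_bound l N -> op_bound (k * l) (M *m N).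
Proof.
move=> l0 Mk Nl v; rewrite mulmxA; apply: le_trans (Nl _) _.
rewrite exprMn (mulrC (k ^+ 2)) -[in leRHS]mulrA. apply: ler_wpM2l; [exact: exprn_ge0|exact: Mk].
Qed.

Lemma op_bound_entry m n k (M : 'M[C]_(m, n)) i j :
  0 <= k -> op_bound k M -> `|M i j| <= k.
Proof.
move=> k0 Mk; rewrite -(@ler_pXn2r _ 2) ?nnegrE //.
have := Mk (delta_mx 0 i : 'rV_m); rewrite sqnorm_delta mulr1; apply: le_trans.
have -> : M i j = ((delta_mx 0 i : 'rV_m) *m M) 0 j.
  by rewrite -rowE mxE.
exact: sqnorm_coord.
Qed.

Lemma gram_unit r m (B : 'M[C]_(r, m)) : row_free B -> B *m B^t* \in unitmx.
Proof.
move=> Bfree; rewrite -row_free_unit; apply/inj_row_free => v vG.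
have vB : v *m B = 0.
  apply: sqnorm_eq0; rewrite sqnormE trmx_mul map_mxM mulmxA -(mulmxA v).
  by rewrite vG mul0mx mxE.
by apply: (row_free_inj Bfree); rewrite mul0mx.
Qed.

(** Pythagoras: the gap between the two squared norms is the squared norm of
    the component of v that the projection P kills. *)
Lemma orthoproj_contraction n (P : 'M[C]_n) :
  P^t* = P -> P *m P = P -> op_bound 1 P.
Proof.
move=> Pherm PP v; rewrite expr1n mul1r -subr_ge0.
have PE : sqnorm (v *m P) = (v *m P *m v^t*) 0 0.
  by rewrite sqnormE trmx_mul map_mxM Pherm mulmxA -(mulmxA v P) PP.
suff -> : sqnorm v - sqnorm (v *m P) = sqnorm (v - v *m P).
  exact: sqnorm_ge0.
rewrite [RHS]sqnormE PE sqnormE.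
rewrite [(v - _)^T]raddfB /= map_mxB trmx_mul map_mxM Pherm.
rewrite mulmxBr !mulmxBl !mulmxA -(mulmxA v P P) PP subrr subr0.
by rewrite !mxE.
Qed.

(** Equal Gram matrices mean that sending each row of P to the corresponding
    row of Q is well defined and isometric on the row space of P. Extending this
    isometry by 0 on the orthogonal complement, that is, composing it with the
    orthogonal projection onto that row space, gives a contraction W of the
    whole space. *)
Lemma gram_eq_contraction n m p (P : 'M[C]_(n, m)) (Q : 'M[C]_(n, p)) :
  P *m P^t* = Q *m Q^t* -> exists2 W, op_bound 1 W & P *m W = Q.
Proof.
move=> PQ.
(* With B a basis of the row space of P, B^t* (B B^t* )^-1 B is the orthogonal
   projection onto it; W0 is this projection in the coordinates of B. *)
have [B [X [Y [Bfree PE BE]]]] : exists (B : 'M[C]_(\rank P, m)) X Y,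
    [/\ row_free B, P = X *m B & B = Y *m P].
  have /submxP[X PE] : (P <= row_base P)%MS by rewrite eq_row_base.
  have /submxP[Y BE] : (row_base P <= P)%MS by rewrite eq_row_base.
  by exists (row_base P), X, Y; split => //; exact: row_base_free.
have [G GE] : exists G, G = B *m B^t* by exists (B *m B^t*).
have Gu : G \in unitmx by rewrite GE; exact: gram_unit.
have GE' : G = (Y *m Q) *m (Y *m Q)^t*.
  rewrite GE {1 2}BE !trmx_mul !map_mxM !mulmxA -(mulmxA Y) -(mulmxA Y).
  by rewrite PQ !mulmxA.
have Gherm : G^t* = G by rewrite GE trmx_mul map_mxM trmxCK.
have [W0 W0E] : exists W0, W0 = B^t* *m invmx G by eexists.
have BW0 : B *m W0 = 1%:M by rewrite W0E mulmxA -GE mulmxV.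
have W0tE : W0^t* = invmx G *m B.
  by rewrite W0E trmx_mul map_mxM trmxCK trmx_inv map_invmx Gherm.
(* B and Y *m Q have the same Gram matrix G, so either can be used after W0
   without changing norms. *)
have sqE v k (Z : 'M[C]_(_, k)) : G = Z *m Z^t* ->
    sqnorm (v *m (W0 *m Z)) = (v *m W0 *m G *m (v *m W0)^t*) 0 0.
  by move=> ->; rewrite sqnormE !mulmxA [in LHS]trmx_mul map_mxM mulmxA.
exists (W0 *m (Y *m Q)) => [v|].
  rewrite (sqE v _ _ GE') -(sqE v _ B GE).
  apply: orthoproj_contraction.
    by rewrite trmx_mul map_mxM W0tE W0E mulmxA.
  by rewrite -mulmxA (mulmxA B) BW0 mul1mx.
have -> : P *m (W0 *m (Y *m Q)) = X *m Y *m Q.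
  by rewrite {1}PE -(mulmxA X) (mulmxA B) BW0 mul1mx mulmxA.
(* P and Q satisfy the same linear relations among rows, since the norm of a
   combination of rows depends only on the Gram matrix; X *m Y - 1 is a matrix
   of such relations for P. *)
have XYP : X *m Y *m P - P = 0 by rewrite -mulmxA -BE -PE subrr.
apply/eqP; rewrite -subr_eq0; apply/eqP/row_matrixP => i; rewrite row0.
apply: sqnorm_eq0.
have E k (Z : 'M[C]_(n, k)) : sqnorm (row i (X *m Y *m Z - Z)) =
    (row i (X *m Y - 1%:M) *m (Z *m Z^t*) *m (row i (X *m Y - 1%:M))^t*) 0 0.
  have -> : X *m Y *m Z - Z = (X *m Y - 1%:M) *m Z by rewrite mulmxBl mul1mx.
  by rewrite row_mul sqnormE trmx_mul map_mxM !mulmxA.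
by rewrite E -PQ -E XYP row0 sqnorm0.
Qed.

(** The Kolmogorov factorization of a finite kernel: diagonalize A in a unitary
    basis and take square roots of the eigenvalues. *)
Lemma psd_factor n (A : 'M[C]_n) :
    A^t* = A -> (forall r : 'rV_n, 0 <= (r *m A *m r^t*) 0 0) ->
  exists G : 'M[C]_n, A = G *m G^t*.
Proof.
move=> Aherm Apos.
have /orthomx_spectralP AE : A \is normalmx by apply/normalmxP; rewrite Aherm.
set P := spectralmx A in AE; set d := spectral_diag A in AE.
have Pu : P \is unitarymx := spectral_unitarymx A.
have d0 i : 0 <= d 0 i.
  have := Apos (row i P).
  rewrite AE invmx_unitary // mulmxA mulmxA -row_mul (unitarymxP Pu).
  have -> : (row i P)^t* = P^t* *m col i 1%:M.
    by rewrite tr_row map_col col1 colE.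
  rewrite -!mulmxA (mulmxA P) (unitarymxP Pu) mul1mx col1 row1.
  by rewrite mulmxA -rowE -colE !mxE eqxx mulr1n.
pose s := map_mx sqrtC d.
exists (P^t* *m diag_mx s).
rewrite {1}AE invmx_unitary // trmx_mul map_mxM trmxCK tr_diag_mx map_diag_mx.
rewrite !mulmxA -(mulmxA (P^t*)) mulmx_diag; congr (_ *m diag_mx _ *m _).
apply/rowP => i; rewrite !mxE -normCK ger0_norm ?sqrtC_ge0 //.
by rewrite sqrtCK.
Qed.
End OperatorBounds.

(** * Transfer functions of contractive block matrices *)

Section Transfer.
Variables (C : numClosedFieldType) (p q n : nat).
Variable W : 'M[C]_(p + n, q + n).
Hypothesis Wcontr : op_bound 1 W.

Local Notation A := (ulsubmx W).
Local Notation B := (ursubmx W).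
Local Notation K := (dlsubmx W).
Local Notation D := (drsubmx W).

Definition resolvent (z : C) := invmx (1%:M - z *: D).

Definition transfer (z : C) := A + z *: (B *m resolvent z *m K).

(** The complex derivative of [transfer], by the resolvent identities. *)
Definition transfer_deriv (z : C) := B *m resolvent z *m resolvent z *m K.

Lemma sqnorm_mul_block (u : 'rV[C]_p) (x : 'rV[C]_n) :
  sqnorm (u *m A + x *m K) + sqnorm (u *m B + x *m D) <= sqnorm u + sqnorm x.
Proof.
rewrite -!sqnorm_row_mx -mul_row_block submxK.
by have := Wcontr (row_mx u x); rewrite expr1n mul1r.
Qed.

Lemma ursubmx_contraction : op_bound 1 B.
Proof.
move=> u; rewrite expr1n mul1r.
have := sqnorm_mul_block u 0; rewrite !mul0mx !addr0.
by rewrite sqnorm0 addr0; apply: le_trans; rewrite lerDr sqnorm_ge0.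
Qed.

Lemma dsubmx_contraction : op_bound 1 K /\ op_bound 1 D.
Proof.
split=> x; rewrite expr1n mul1r; have := sqnorm_mul_block 0 x;
  rewrite !mul0mx !add0r sqnorm0 add0r; apply: le_trans.
- by rewrite lerDl sqnorm_ge0.
- by rewrite lerDr sqnorm_ge0.
Qed.

(** Convexity of the square, for the combination
    w + z d = (1 - |z|) (w / (1 - |z|)) + |z| (z d / |z|), with the denominators
    cleared. Unlike the triangle inequality of the Euclidean norm, it can be
    summed over the coordinates. *)
Lemma normD_scaled_le (z w d : C) : `|z| < 1 ->
  (1 - `|z|) * `|w + z * d| ^+ 2 <= `|w| ^+ 2 + `|z| * (1 - `|z|) * `|d| ^+ 2.
Proof.
move=> z1; have r0 : 0 <= 1 - `|z| by rewrite subr_ge0 ltW.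
have le1 : `|w + z * d| ^+ 2 <= (`|w| + `|z| * `|d|) ^+ 2.
  by rewrite ler_sqr ?nnegrE ?addr_ge0 ?mulr_ge0// -normrM ler_normD.
apply: le_trans (ler_wpM2l r0 le1) _.
rewrite -subr_ge0.
have -> : `|w| ^+ 2 + `|z| * (1 - `|z|) * `|d| ^+ 2
   - (1 - `|z|) * (`|w| + `|z| * `|d|) ^+ 2
  = `|z| * (`|w| - (1 - `|z|) * `|d|) ^+ 2 by ring.
by rewrite mulr_ge0// real_exprn_even_ge0// rpredB ?rpredM ?rpredB ?rpred1 ?normr_real.
Qed.

(** The Neumann bound |v (1 - z D)| >= (1 - |z|) |v|, which holds because D is
    a contraction. *)
Lemma resolvent_lower_bound (z : C) (v : 'rV[C]_n) : `|z| < 1 ->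
  (1 - `|z|) ^+ 2 * sqnorm v <= sqnorm (v *m (1%:M - z *: D)).
Proof.
move=> z1; have r0 : 0 <= 1 - `|z| by rewrite subr_ge0 ltW.
set w := v *m _.
have vE : v = w + z *: (v *m D).
  by rewrite /w mulmxBr mulmx1 -scalemxAr subrK.
have le1 : (1 - `|z|) * sqnorm v <=
    sqnorm w + `|z| * (1 - `|z|) * sqnorm (v *m D).
  rewrite [in leLHS]vE /sqnorm !mulr_sumr -big_split /=; apply: ler_sum => j _.
  by rewrite [(w + _) 0 j]mxE [(z *: (v *m D)) 0 j]mxE; exact: normD_scaled_le.
have := dsubmx_contraction.2 v; rewrite expr1n mul1r => Dv.
have le2 := ler_wpM2l (mulr_ge0 (normr_ge0 z) r0) Dv.
have {}le1 := le_trans le1 (lerD (lexx (sqnorm w)) le2).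
rewrite -subr_ge0; move: le1; rewrite -subr_ge0; congr (0 <= _); ring.
Qed.

Lemma resolvent_unit (z : C) : `|z| < 1 -> 1%:M - z *: D \in unitmx.
Proof.
move=> z1; rewrite -row_free_unit; apply/inj_row_free => v v0.
have := resolvent_lower_bound v z1; rewrite v0 sqnorm0 pmulr_rle0; first exact: sqnorm_eq0.
by rewrite exprn_gt0// subr_gt0.
Qed.

Lemma resolvent_bound (z : C) : `|z| < 1 ->
  op_bound (1 - `|z|)^-1 (resolvent z).
Proof.
move=> z1 w; have r0 : 0 < (1 - `|z|) ^+ 2 by rewrite exprn_gt0// subr_gt0.
have := resolvent_lower_bound (w *m resolvent z) z1.
rewrite -mulmxA mulVmx ?resolvent_unit// mulmx1.
by rewrite exprVn mulrC [_^-1 * _]mulrC -ler_pdivlMr.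
Qed.

(** Eliminating the state x from the two block rows of the system: the second
    gives x = u B (1 - z D)^-1, and the first then reads v = u T(z). *)
Lemma transfer_interpolation (z : C) (u : 'rV[C]_p) (v : 'rV[C]_q)
    (x : 'rV[C]_n) : `|z| < 1 ->
  row_mx u (z *: x) *m W = row_mx v x -> u *m transfer z = v.
Proof.
move=> z1; rewrite -{1}(submxK W) mul_row_block => /eq_row_mx[vE xE].
have xE' : x = u *m B *m resolvent z.
  have : x *m (1%:M - z *: D) = u *m B.
    by rewrite mulmxBr mulmx1 -{1}xE -scalemxAl -scalemxAr addrK.
  by move/(congr1 (mulmx^~ (resolvent z))); rewrite /= mulmxK ?resolvent_unit.
by rewrite -vE xE' /transfer mulmxDr -scalemxAr -scalemxAl !mulmxA.
Qed.

(** Energy balance: feeding (u, z x) into W gives back (u T(z), x), and the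
    state x comes out at least as large as the part z x that went in. *)
Lemma transfer_contraction (z : C) : `|z| < 1 -> op_bound 1 (transfer z).
Proof.
move=> z1 u; rewrite expr1n mul1r.
set x := u *m B *m resolvent z.
have xE : u *m B + (z *: x) *m D = x.
  have : x *m (1%:M - z *: D) = u *m B by rewrite mulmxKV ?resolvent_unit.
  by move<-; rewrite mulmxBr mulmx1 -scalemxAl -scalemxAr subrK.
have := sqnorm_mul_block u (z *: x); rewrite xE.
have -> : u *m A + (z *: x) *m K = u *m transfer z.
  by rewrite /x /transfer mulmxDr -scalemxAr -scalemxAl !mulmxA.
rewrite -lerBrDr => /le_trans; apply; rewrite -addrA gerDl subr_le0 sqnormZ.
by rewrite ler_piMl ?sqnorm_ge0// expr_le1// ltW.
Qed.

Let pencil z := 1%:M - z *: D.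

Let resolventK z : `|z| < 1 -> resolvent z *m pencil z = 1%:M.
Proof. by move=> z1; rewrite mulVmx ?resolvent_unit. Qed.

Let pencilK z : `|z| < 1 -> pencil z *m resolvent z = 1%:M.
Proof. by move=> z1; rewrite mulmxV ?resolvent_unit. Qed.

Let pencil_inj z w (X Y : 'M[C]_n) : `|z| < 1 -> `|w| < 1 ->
  pencil w *m X *m pencil z = pencil w *m Y *m pencil z -> X = Y.
Proof.
move=> z1 w1 /(congr1 (fun M => resolvent w *m M *m resolvent z)).
by rewrite !mulmxA !resolventK// !mul1mx -!mulmxA !pencilK// !mulmx1.
Qed.

Lemma resolvent_identity z w : `|z| < 1 -> `|w| < 1 ->
  resolvent w - resolvent z = (w - z) *: (resolvent w *m D *m resolvent z).
Proof.
move=> z1 w1; apply: (pencil_inj z1 w1).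
rewrite [pencil w *m _]mulmxBr [LHS]mulmxBl pencilK// mul1mx -[_ *m resolvent z *m _]mulmxA.
rewrite resolventK// mulmx1.
rewrite -scalemxAr -scalemxAl !mulmxA pencilK// mul1mx -mulmxA resolventK//.
by rewrite mulmx1 /pencil opprB addrC addrA subrK scalerBl.
Qed.

Lemma resolvent_scaled_identity z w : `|z| < 1 -> `|w| < 1 ->
  w *: resolvent w - z *: resolvent z = (w - z) *: (resolvent w *m resolvent z).
Proof.
move=> z1 w1; apply: (pencil_inj z1 w1).
rewrite [pencil w *m _]mulmxBr [LHS]mulmxBl -!scalemxAr -!scalemxAl pencilK// mul1mx.
rewrite -[_ *m resolvent z *m _]mulmxA resolventK// mulmx1 !mulmxA pencilK// mul1mx resolventK//.
by rewrite /pencil !scalerBr !scalerA (mulrC z) opprB addrA subrK scalerBl.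
Qed.

(** An exact first-order Taylor formula. Its remainder is a product of
    contractions and resolvents, hence is bounded independently of W and even
    of the dimension of the state space. *)
Lemma transfer_remainder z w : `|z| < 1 -> `|w| < 1 ->
  transfer w - transfer z - (w - z) *: transfer_deriv z =
  (w - z) ^+ 2 *: (B *m resolvent w *m D *m resolvent z *m resolvent z *m K).
Proof.
move=> z1 w1.
have -> : transfer w - transfer z
    = (w - z) *: (B *m (resolvent w *m resolvent z) *m K).
  rewrite /transfer opprD addrACA subrr add0r scalemxAl scalemxAr.
  rewrite [z *: _]scalemxAl [z *: _]scalemxAr -mulmxBl -mulmxBr.
  rewrite resolvent_scaled_identity//.
  by rewrite -scalemxAr -scalemxAl.
rewrite -scalerBr expr2 -scalerA; congr (_ *: _).
have -> : B *m (resolvent w *m resolvent z) *m K - transfer_deriv z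
    = B *m ((resolvent w - resolvent z) *m resolvent z) *m K.
  by rewrite mulmxBl mulmxBr mulmxBl /transfer_deriv !mulmxA.
by rewrite resolvent_identity// -scalemxAl -scalemxAr -scalemxAl !mulmxA.
Qed.

Lemma transfer_deriv_bound z i j : `|z| < 1 ->
  `|transfer_deriv z i j| <= (1 - `|z|)^-1 ^+ 2.
Proof.
move=> z1; have r0 : 0 <= (1 - `|z|)^-1 by rewrite invr_ge0 subr_ge0 ltW.
apply: op_bound_entry; first by rewrite exprn_ge0.
rewrite -[_ ^+ 2]mulr1; apply: op_boundM => //; last exact: dsubmx_contraction.1.
rewrite expr2; apply: op_boundM => //; last exact: resolvent_bound.
rewrite -[_^-1]mul1r; apply: op_boundM => //; last exact: resolvent_bound.
exact: ursubmx_contraction.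
Qed.

Lemma transfer_remainder_bound z w i j : `|z| < 1 -> `|w| < 1 ->
  `|transfer w i j - transfer z i j - (w - z) * transfer_deriv z i j|
    <= `|w - z| ^+ 2 * ((1 - `|w|)^-1 * (1 - `|z|)^-1 ^+ 2).
Proof.
move=> z1 w1.
have rz0 : 0 <= (1 - `|z|)^-1 by rewrite invr_ge0 subr_ge0 ltW.
have rw0 : 0 <= (1 - `|w|)^-1 by rewrite invr_ge0 subr_ge0 ltW.
have E (X Y Z : 'M[C]_(p, q)) a :
    X i j - Y i j - a * Z i j = (X - Y - a *: Z) i j by rewrite !mxE.
have scaleE a (X : 'M[C]_(p, q)) : (a *: X) i j = a * X i j by rewrite mxE.
rewrite E transfer_remainder// scaleE normrM normrX ler_wpM2l ?exprn_ge0//.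
apply: op_bound_entry; first by rewrite mulr_ge0// exprn_ge0.
rewrite -[_ * _]mulr1; apply: op_boundM => //; last exact: dsubmx_contraction.1.
rewrite expr2 mulrA; apply: op_boundM => //; last exact: resolvent_bound.
apply: op_boundM => //; last exact: resolvent_bound.
rewrite -[_^-1]mulr1; apply: op_boundM => //; last exact: dsubmx_contraction.2.
rewrite -[_^-1]mul1r; apply: op_boundM => //; last exact: resolvent_bound.
exact: ursubmx_contraction.
Qed.
End Transfer.

(** * Interpolation at finitely many points *)

Section FiniteInterpolation.
Local Open Scope sesquilinear_scope.
Variables (C : numClosedFieldType) (p q : nat).

(** A Schur function T together with its derivative T', with analyticity
    expressed by a first-order Taylor estimate whose constants are universal.
    In this form the property is closed under pointwise limits. *)
Definition schur_jet (T T' : C -> 'M[C]_(p, q)) := forall z, `|z| < 1 ->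
  [/\ op_bound 1 (T z),
      forall i j, `|T' z i j| <= (1 - `|z|)^-1 ^+ 2
    & forall w i j, `|w| < 1 ->
        `|T w i j - T z i j - (w - z) * T' z i j|
          <= `|w - z| ^+ 2 * ((1 - `|w|)^-1 * (1 - `|z|)^-1 ^+ 2)].

Lemma transfer_schur_jet n (W : 'M[C]_(p + n, q + n)) :
  op_bound 1 W -> schur_jet (transfer W) (transfer_deriv W).
Proof.
move=> W1 z z1; split=> [|i j|w i j w1].
- exact: transfer_contraction.
- exact: transfer_deriv_bound.
- exact: transfer_remainder_bound.
Qed.

(** The lurking isometry. Writing N i j as the inner product of vectors k_i and
    k_j, the hypothesis says that the rows (u_i, z_i k_i) and (v_i, k_i) have the
    same Gram matrix. A contraction W carrying the former to the latter has a
    transfer function that solves u_i T(z_i) = v_i. *)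
Lemma finite_interpolation n (z : 'I_n -> C) (u : 'I_n -> 'rV[C]_p)
    (v : 'I_n -> 'rV[C]_q) (N : 'I_n -> 'I_n -> C) :
    (forall i, `|z i| < 1) ->
    (forall c : 'I_n -> C, 0 <= \sum_i \sum_j (c i)^* * c j * N i j) ->
    (forall i j, (u i *m (u j)^t*) 0 0 - (v i *m (v j)^t*) 0 0
                 = (1 - (z j)^* * z i) * N i j) ->
  exists T T', schur_jet T T' /\ forall i, u i *m T (z i) = v i.
Proof.
move=> z1 Npsd eqN.
have nz i j : 1 - (z j)^* * z i != 0.
  rewrite subr_eq0; apply/eqP => E.
  have: `|(z j)^* * z i| < 1 by rewrite normrM norm_conjC mulr_ilt1.
  by rewrite -E normr1 ltxx.
have dotC m (x y : 'rV[C]_m) : ((x *m y^t*) 0 0)^* = (y *m x^t*) 0 0.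
  rewrite !mxE rmorph_sum; apply: eq_bigr => k _.
  by rewrite !mxE rmorphM /= conjCK mulrC.
have Nherm i j : (N j i)^* = N i j.
  have := congr1 Num.conj (eqN j i).
  rewrite rmorphB /= !dotC eqN rmorphM rmorphB rmorph1 rmorphM /= conjCK.
  by rewrite [z i * _]mulrC => /(mulfI (nz i j)).
pose M := \matrix_(i, j) N i j.
have [||G MG] := @psd_factor C n M.
- by apply/matrixP => i j; rewrite !mxE.
- move=> r; have := Npsd (fun i => (r 0 i)^*); congr (0 <= _).
  rewrite exchange_big mxE; apply: eq_bigr => j _.
  rewrite !mxE mulr_suml; apply: eq_bigr => i _.
  by rewrite !mxE conjCK mulrAC.
pose P := \matrix_(i < n) row_mx (u i) (z i *: row i G).
pose Q := \matrix_(i < n) row_mx (v i) (row i G).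
have rowdot m (H : 'M[C]_(n, m)) i j : (H *m H^t*) i j = (row i H *m (row j H)^t*) 0 0.
  by rewrite !mxE; apply: eq_bigr => k _; rewrite !mxE.
have PQ : P *m P^t* = Q *m Q^t*.
  apply/matrixP => i j; rewrite !rowdot !rowK.
  have NG : N i j = (row i G *m (row j G)^t*) 0 0.
    by rewrite -rowdot -MG mxE.
  rewrite !tr_row_mx !map_col_mx !mul_row_col linearZ /= map_mxZ.
  rewrite -scalemxAl -scalemxAr scalerA.
  have addE (X Y : 'M[C]_1) : (X + Y) 0 0 = X 0 0 + Y 0 0 by rewrite mxE.
  have scaleE a (X : 'M[C]_1) : (a *: X) 0 0 = a * X 0 0 by rewrite mxE.
  rewrite !addE scaleE -NG; move/eqP: (eqN i j).
  rewrite mulrBl mul1r subr_eq => /eqP ->.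
  by rewrite [_^* * z i]mulrC addrAC subrK addrC.
have [W W1 WPQ] := gram_eq_contraction PQ.
exists (transfer W), (transfer_deriv W); split; first exact: transfer_schur_jet.
move=> i; apply: (transfer_interpolation W1 (z1 i) (x := row i G)).
by move: (congr1 (row i) WPQ); rewrite row_mul !rowK.
Qed.
End FiniteInterpolation.

(** * Limits along an ultrafilter *)

Section UltrafilterLimits.
Local Open Scope classical_set_scope.
Variables (R : realType) (I : Type) (U : set_system I).
Hypothesis Uultra : UltraFilter U.
Local Notation C := R[i].

Lemma fmap_ultra (T : Type) (f : I -> T) : UltraFilter (f @ U).
Proof.
split; first exact: fmap_proper_filter.
move=> G GF UG; rewrite predeqE => A; split; last exact: UG.
move=> GA; have [//|UnA] := in_ultra_setVsetC (f @^-1` A) Uultra.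
have GnA : G (~` A) by exact: UG.
have := filterI GA GnA; rewrite setICr => G0.
by case: (@filter_not_empty _ G GF (G0 _)).
Qed.

Lemma bounded_ultra_cvg_real (f : I -> R) (M : R) :
  (forall i, `|f i| <= M) -> exists l : R, f @ U --> l.
Proof.
move=> fM; have Uf := fmap_ultra f.
have := @segment_compact R (- M) M; rewrite compact_ultra => /(_ _ Uf)[].
  by apply: (@filterE _ U) => i /=; rewrite in_itv /= -ler_norml.
by move=> l [_ fl]; exists l.
Qed.

Lemma bounded_ultra_cvg (f : I -> C^o) (M : C) :
  (forall i, `|f i| <= M) -> exists l : C^o, f @ U --> l.
Proof.
move=> fM.
have reC (z : C) : `|complex.Re z| <= complex.Re `|z|.
  by rewrite normc_def /= -sqrtr_sqr ler_wsqrtr// lerDl sqr_ge0.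
have imC (z : C) : `|complex.Im z| <= complex.Re `|z|.
  by rewrite normc_def /= -sqrtr_sqr ler_wsqrtr// lerDr sqr_ge0.
have mono (z w : C) : z <= w -> complex.Re z <= complex.Re w.
  by rewrite lecE => /andP[].
have [a fa] := @bounded_ultra_cvg_real (fun i => complex.Re (f i)) (complex.Re M)
  (fun i => le_trans (reC _) (mono _ _ (fM i))).
have [b fb] := @bounded_ultra_cvg_real (fun i => complex.Im (f i)) (complex.Re M)
  (fun i => le_trans (imC _) (mono _ _ (fM i))).
exists (Complex a b); apply/cvgrPdist_lt => e e0.
have [e' E] : exists e' : R, e = (e')%:C%C.
  by exists (complex.Re e); rewrite RRe_real// gtr0_real.
move: e0; rewrite E ltcR => e0.
have fa' := (cvgrPdist_lt _ _).1 fa (e' / 2) ltac:(by rewrite divr_gt0).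
have fb' := (cvgrPdist_lt _ _).1 fb (e' / 2) ltac:(by rewrite divr_gt0).
near=> i.
rewrite normc_def ltcR.
have ai : `|a - complex.Re (f i)| < e' / 2 by near: i; exact: fa'.
have bi : `|b - complex.Im (f i)| < e' / 2 by near: i; exact: fb'.
move: ai bi; case: (f i) => x y /=; rewrite !ltr_norml => /andP[xl xr] /andP[yl yr].
rewrite -[ltRHS]gtr0_norm// -sqrtr_sqr ltr_sqrt ?exprn_gt0//.
nra.
Unshelve. all: by end_near.
Qed.

(** In the complex field being nonnegative is the closed condition z = |z|. *)
Lemma ultra_lim_ge0 (f : I -> C^o) (l : C^o) :
  f @ U --> l -> (forall i, 0 <= f i) -> 0 <= l.
Proof.
move=> fl f0; suff -> : l = `|l| :> C by exact: normr_ge0.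
apply: (cvg_unique (@norm_hausdorff C C^o) fl).
have -> : f = (fun i => `|f i|) by apply/funext => i; rewrite ger0_norm.
exact: (@cvg_norm C C^o).
Qed.

Lemma ultra_lim_norm_le (f : I -> C^o) (l : C^o) (c : C) :
  f @ U --> l -> (forall i, `|f i| <= c) -> `|l| <= c.
Proof.
move=> fl fc; rewrite -subr_ge0.
apply: (@ultra_lim_ge0 (fun i => c - `|f i|)).
  by apply: (@cvgB C C^o); [exact: cvg_cst|exact: (@cvg_norm C C^o)].
by move=> i; rewrite subr_ge0.
Qed.

Lemma ultra_cvg_sum n (f : 'I_n -> I -> C^o) (l : 'I_n -> C^o) :
  (forall i, f i @ U --> l i) -> \sum_i f i s @[s --> U] --> \sum_i l i.
Proof. by move=> fl; apply: cvg_big => //; exact: add_continuous. Qed.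

Variables (p q : nat) (T_ T'_ : I -> C -> 'M[C]_(p, q)).
Hypothesis jets : forall s, schur_jet (T_ s) (T'_ s).

(** The entries of Schur functions and of their derivatives are bounded at each
    point of the disc, so they converge along U; every clause of [schur_jet] is
    a closed condition on finitely many of these values. *)
Lemma ultra_lim_schur_jet : exists T T', schur_jet T T' /\
  forall z i j, `|z| < 1 -> (fun s => T_ s z i j : C^o) @ U --> (T z i j : C^o).
Proof.
have exT (z : C) i j : exists l : C^o,
    `|z| < 1 -> (fun s => T_ s z i j : C^o) @ U --> l.
  have [z1|] := boolP (`|z| < 1); last by exists 0.
  have [|l Tl] := @bounded_ultra_cvg (fun s => T_ s z i j) 1; last by exists l.
  by move=> s; have [/op_bound_entry + _ _] := jets s z1; apply.
have exT' (z : C) i j : exists l : C^o,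
    `|z| < 1 -> (fun s => T'_ s z i j : C^o) @ U --> l.
  have [z1|] := boolP (`|z| < 1); last by exists 0.
  have [|l Tl] := @bounded_ultra_cvg (fun s => T'_ s z i j) ((1 - `|z|)^-1 ^+ 2);
    last by exists l.
  by move=> s; have [_ + _] := jets s z1; apply.
pose T z := \matrix_(i, j) sval (cid (exT z i j)) : 'M[C]_(p, q).
pose T' z := \matrix_(i, j) sval (cid (exT' z i j)) : 'M[C]_(p, q).
have Tlim z i j : `|z| < 1 -> (fun s => T_ s z i j : C^o) @ U --> (T z i j : C^o).
  by rewrite mxE; exact: (svalP (cid (exT z i j))).
have Tlim' z i j : `|z| < 1 -> (fun s => T'_ s z i j : C^o) @ U --> (T' z i j : C^o).
  by rewrite mxE; exact: (svalP (cid (exT' z i j))).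
exists T, T'; split; last exact: Tlim.
move=> z z1; split.
- move=> v; rewrite -subr_ge0.
  apply: (@ultra_lim_ge0 (fun s => 1 ^+ 2 * sqnorm v - sqnorm (v *m T_ s z))).
    apply: (@cvgB C C^o); first exact: cvg_cst.
    rewrite /sqnorm; apply: ultra_cvg_sum => j.
    have vTlim : (fun s => (v *m T_ s z) 0 j : C^o) @ U --> ((v *m T z) 0 j : C^o).
      have coordE (M : 'M[C]_(p, q)) : (v *m M) 0 j = \sum_k v 0 k * M k j.
        by rewrite mxE.
      under eq_fun do rewrite coordE.
      rewrite coordE; apply: ultra_cvg_sum => k.
      by apply: (@cvgM C); [exact: cvg_cst|exact: Tlim].
    by apply: (@cvgM C); exact: (@cvg_norm C C^o).
  by move=> s; rewrite subr_ge0; have [+ _ _] := jets s z1; apply.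
- move=> i j; apply: (ultra_lim_norm_le (Tlim' _ _ _ z1)) => s.
  by have [_ + _] := jets s z1; apply.
- move=> w i j w1.
  apply: (@ultra_lim_norm_le
    (fun s => T_ s w i j - T_ s z i j - (w - z) * T'_ s z i j)).
    apply: (@cvgB C C^o); first by apply: (@cvgB C C^o); exact: Tlim.
    by apply: (@cvgM C); [exact: cvg_cst|exact: Tlim'].
  by move=> s; have [_ _ +] := jets s z1; apply.
Qed.
End UltrafilterLimits.

(** * Interpolation on an arbitrary set of points *)

Section Interpolation.
Local Open Scope classical_set_scope.
Local Open Scope sesquilinear_scope.
Variables (R : realType) (p q : nat).
Local Notation C := R[i].

(** Sequences stand for finite sets of points, directed by inclusion, so that a
    condition attached to a single point holds eventually. *)
Definition eventually_in (X : eqType) : set_system (seq X) :=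
  [set A : set (seq X) | exists s0 : seq X, forall s : seq X, {subset s0 <= s} -> A s].

Lemma eventually_in_proper (X : eqType) : ProperFilter (@eventually_in X).
Proof.
split; first by move=> [s0 /(_ s0)]; apply.
split=> [|A B [s As] [t Bt]|A B AB [s As]].
- by exists [::].
- exists (s ++ t) => r st; split.
    by apply: As => x xs; apply: st; rewrite mem_cat xs.
  by apply: Bt => x xt; apply: st; rewrite mem_cat xt orbT.
- by exists s => t st; apply/AB/As.
Qed.

(** Solve on each finite set of points, and take the limit of the solutions
    along an ultrafilter that refines the inclusion of finite sets. A given
    equation u x T(z x) = v x holds eventually along it, hence in the limit. *)
Theorem kernel_interpolation (X : eqType) (z : X -> C) (u : X -> 'rV[C]_p)
    (v : X -> 'rV[C]_q) (N : X -> X -> C) :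
    (forall x, `|z x| < 1) -> positive_semidefinite N ->
    (forall x y, (u x *m (u y)^t*) 0 0 - (v x *m (v y)^t*) 0 0
                 = (1 - (z y)^* * z x) * N x y) ->
  exists T T', schur_jet T T' /\ forall x, u x *m T (z x) = v x.
Proof.
move=> z1 Npsd eqN.
have finite (s : seq X) : exists TT : (C -> 'M[C]_(p, q)) * (C -> 'M[C]_(p, q)),
    schur_jet TT.1 TT.2 /\ forall x, x \in s -> u x *m TT.1 (z x) = v x.
  pose t := in_tuple s.
  have [T [T' [TT' Tt]]] := finite_interpolation (z := z \o tnth t) (u := u \o tnth t)
    (v := v \o tnth t) (N := fun i j => N (tnth t i) (tnth t j))
    (fun i => z1 _) (fun c => Npsd _ _ c) (fun i j => eqN _ _).
  exists (T, T'); split => // x /(tnthP t)[i ->]; exact: Tt.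
pose TT s := sval (cid (finite s)).
have jets s : schur_jet (TT s).1 (TT s).2 by case: (svalP (cid (finite s))).
have [U [Uultra sU]] := ultraFilterLemma (eventually_in_proper X).
have [T [T' [jetT Tlim]]] := ultra_lim_schur_jet Uultra jets.
exists T, T'; split => // x; apply/rowP => j.
have E (M : 'M[C]_(p, q)) : (u x *m M) 0 j = \sum_k u x 0 k * M k j by rewrite mxE.
apply: (@cvg_unique C^o (@norm_hausdorff C C^o)
   ((fun s => (u x *m (TT s).1 (z x)) 0 j) @ U)).
  have -> : (fun s => (u x *m (TT s).1 (z x)) 0 j)
      = (fun s => \sum_k u x 0 k * (TT s).1 (z x) k j).
    by apply/funext => s; rewrite E.
  rewrite /= E; apply: (ultra_cvg_sum Uultra) => k.
  by apply: (@cvgM C); [exact: cvg_cst|exact: Tlim].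
apply: cvg_near_cst; apply: sU; exists [:: x] => s xs /=.
by case: (svalP (cid (finite s))) => _ -> //; apply: xs; rewrite inE.
Qed.

(** The transpose turns the row convention of [op_bound] into the action of
    matrices on columns. *)
Lemma schur_jet_differentiable (T T' : C^o -> 'M[C]_(p, q)) (z : C^o) :
  schur_jet T T' -> `|z| < 1 ->
  differentiable (fun w : C^o => (T w)^T : 'M[C]_(q, p)) z.
Proof.
move=> TT' z1; apply/derivable1_diffP; apply/cvg_ex; exists (T' z)^T.
set r := 1 - `|z|; have r0 : 0 < r by rewrite subr_gt0.
have [_ _ rem] := TT' z z1.
apply/cvg_ballP => e e0.
(* The constant of the Taylor estimate at all w with |w - z| < r / 2. *)
pose c := (r / 2)^-1 * r^-1 ^+ 2.
have c0 : 0 < c by rewrite mulr_gt0 ?invr_gt0 ?divr_gt0 ?exprn_gt0 ?invr_gt0.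
near=> h.
have h0 : h != 0 by near: h; exact: nbhs_dnbhs_neq.
have hr : `|h| < r / 2 by near: h; apply: dnbhs0_lt; rewrite divr_gt0.
have hc : `|h| < e / c by near: h; apply: dnbhs0_lt; rewrite divr_gt0.
split => // j i; rewrite -ball_normE /ball_ /=.
set w := h%:A + z.
have wE : w - z = h by rewrite /w addrK [LHS]mulr1.
have w1 : r / 2 < 1 - `|w|.
  have -> : r / 2 = 1 - (r / 2 + `|z|) by rewrite /r; field.
  rewrite ltrD2l ltrN2; apply: (@le_lt_trans _ _ (`|h| + `|z|)).
    by rewrite -{1}(subrK z w) wE ler_normD.
  by rewrite ltrD2r.
have s0 : 0 < r / 2 by rewrite divr_gt0.
have {}rem : `|T w i j - T z i j - h * T' z i j| <= `|h| ^+ 2 * c.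
  rewrite -{1}wE; apply: le_trans (rem w i j _) _.
    by rewrite -subr_gt0; exact: lt_trans w1.
  rewrite wE ler_wpM2l ?exprn_ge0// /c -/r ler_wpM2r//.
    by rewrite exprn_ge0// invr_ge0 ltW.
  by rewrite lef_pV2 ?posrE ?(lt_trans s0 w1)// ltW.
rewrite !mxE -normrN opprB.
have -> : h^-1 *: (T w i j - T z i j) - T' z i j
    = h^-1 * (T w i j - T z i j - h * T' z i j).
  by rewrite mulrBr mulKf.
have nh0 : 0 < `|h| by rewrite normr_gt0.
rewrite normrM normfV; apply: (@le_lt_trans _ _ (`|h| * c)).
  by rewrite ler_pdivrMl// mulrA -expr2.
by rewrite -ltr_pdivlMr.
Unshelve. all: by end_near.
Qed.
End Interpolation.

(** * Kernels of rank one *)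

Section RankOne.
Variables (R : realType) (X : Type) (N : X -> X -> R[i]).

(** If e0 spans the space then N(., y) = c(y) e0, and the reproducing property
    e0 y = (e0, c(y) e0) gives c(y) = conj(e0 y) / |e0|^2; so f is e0 divided by
    its norm. *)
Lemma rank_one_kernel : kernel_rank N 1 ->
  exists f : X -> R[i], rkhs N f /\ forall x y, N x y = (f y)^* * f x.
Proof.
case=> e [eN free gen].
have [H [ip [hfs He]]] := eN ord0; set e0 := e ord0 in He.
have [[H0 Hlin] [ip_lin ip_herm ip_ge0 ip_def] _ HN repr] := hfs.
pose a := ip e0 e0.
have scaleE c : ip (fun x => c * e0 x) e0 = c * a.
  (* Linearity is only available for maps of the form a f + g. *)
  have -> : (fun x => c * e0 x) = (fun x => (c - 1) * e0 x + e0 x).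
    by apply/funext => x; rewrite mulrBl mul1r subrK.
  by rewrite ip_lin// -/a mulrBl mul1r subrK.
have a0 : 0 <= a by exact: ip_ge0.
have a_neq0 : a != 0.
  apply/eqP => /(ip_def _ He) e00.
  suff /eqP : (1 : R[i]) = 0 by rewrite oner_eq0.
  apply: (free (fun=> 1) _ ord0) => x.
  by rewrite big_ord1 -/e0 e00 mulr0.
have NE x y : N x y = (e0 y)^* * e0 x / a.
  have [c Nc] := gen (fun x => N x y) (ex_intro _ H (ex_intro _ ip (conj hfs (HN y)))).
  have Ny : (fun x => N x y) = (fun x => c ord0 * e0 x).
    by apply/funext => t; rewrite Nc big_ord1.
  have Hc : H (fun x => c ord0 * e0 x) by rewrite -Ny; exact: HN.
  have -> : e0 y = (c ord0 * a)^* by rewrite (repr _ y He) Ny ip_herm// scaleE.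
  by rewrite conjCK Nc big_ord1 mulrAC mulfK.
pose s := sqrtC a.
have s0 : 0 <= s by rewrite sqrtC_ge0.
exists (fun x => s^-1 * e0 x); split=> [|x y].
  exists H, ip; split => //.
  by have := Hlin s^-1 _ _ He H0; under eq_fun do rewrite addr0.
have sJ : (s^-1)^* = s^-1 by rewrite conj_Creal// realV ger0_real.
by rewrite NE -(sqrtCK a) -/s rmorphM /= sJ expr2 invfM; ring.
Qed.
End RankOne.

(** * The Schur class *)

Section OperatorNorm.
Variable R : realType.
Local Notation C := R[i].

Lemma opnorm_trmx_le1 n p (M : 'M[C]_(n, p)) : op_bound 1 M -> opnorm M^T <= 1.
Proof.
move=> M1.
have sqE k (v : 'cV[C]_k) :
    sqnorm v^T = (\sum_(i < k) complex.Re `|v i 0| ^+ 2)%:C%C.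
  rewrite rmorph_sum; apply: eq_bigr => i _.
  by rewrite mxE -{1}[`|v i 0|]RRe_real ?normr_real// -rmorphXn.
apply: ge_sup.
  exists (l2norm (M^T *m 0)), 0 => //=.
  rewrite /l2norm big1 ?sqrtr0// => i _.
  by rewrite mxE normr0 /= expr0n.
move=> _ [v v1 <-]; apply: le_trans v1.
rewrite /l2norm ler_wsqrtr// -lecR -!sqE trmx_mul trmxK.
by have := M1 v^T; rewrite expr1n mul1r.
Qed.
End OperatorNorm.

Theorem theorem4p1 (R : realType)
    (N1 N2 N3 : polydisc R -> polydisc R -> R[i])
    (hN : Rtilde11 N1 N2 N3) :
  exists f1 f2 g : polydisc R -> R[i],
    [/\ [/\ rkhs N1 f1, rkhs N2 f2 & rkhs (Kfun N1 N2 N3) g],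
        forall x y : polydisc R, N1 x y = (f1 y)^* * f1 x,
        forall x y : polydisc R, N2 x y = (f2 y)^* * f2 x,
        forall x y : polydisc R, Kfun N1 N2 N3 x y = (g y)^* * g x
      & exists Xi : disc R -> 'M[R[i]]_3,
          schur_class3 Xi /\
          forall l z1 z2 : disc R,
            let x : polydisc R := (l, (z1, z2)) in
            Xi l *m col3 1 (val z1 * f1 x) (val z2 * f2 x)
              = col3 (g x) (f1 x) (f2 x)].
Proof.
have [[_ _ [N3psd _ _]] _ rank1 rank2 rankK] := hN.
have [f1 [f1N N1E]] := rank_one_kernel rank1.
have [f2 [f2N N2E]] := rank_one_kernel rank2.
have [g [gK KE]] := rank_one_kernel rankK.
exists f1, f2, g; split => //.
have disc_lt1 (l : disc R) : `|val l| < 1 by exact: (set_mem (valP l)).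
pose u (x : polydisc R) := (col3 1 (val x.2.1 * f1 x) (val x.2.2 * f2 x))^T.
pose v (x : polydisc R) := (col3 (g x) (f1 x) (f2 x))^T.
(* The definition of Kfun, rearranged once the three kernels are factored. *)
have lurking (x y : polydisc R) :
    (u x *m ((u y)^t*)%sesqui) 0 0 - (v x *m ((v y)^t*)%sesqui) 0 0
    = (1 - (val y.1)^* * val x.1) * N3 x y.
  have := KE x y; rewrite /Kfun /polydisc_val /= N1E N2E => K.
  rewrite !mxE !big_ord_recr !big_ord0 /= !mxE /=.
  by rewrite !rmorphM rmorph1 /= [g x * _]mulrC -K; ring.
have [T [T' [jet interp]]] :=
  kernel_interpolation (X := polydisc R) (fun x => disc_lt1 x.1) N3psd lurking.
exists (fun l => (T (val l))^T); split; last first.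
  move=> l z1 z2 x; apply: trmx_inj; rewrite trmx_mul trmxK.
  exact: (interp x).
split=> [|l].
  exists (fun z : R[i]^o => (T z)^T) => l; split => //.
  exact: (schur_jet_differentiable jet (disc_lt1 l)).
by apply: opnorm_trmx_le1; have [] := jet _ (disc_lt1 l).
Qed.
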